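(* Let $W$ be one of the complex reflection groups $G_4$ or $G_5$ and let $c\in W$ be a Coxeter element. Two reflection factorizations $(t_1,t_2,\ldots,t_k)$ and $(t_1',t_2',\ldots,t_k')$ of $c$ are in the same Hurwitz orbit if and only if they have the same multiset of conjugacy classes.
   Context: A reflection is a finite-order element of $\mathrm{GL}_n(\mathbb{C})$ whose fixed space is a hyperplane (codimension one). $G_4$ and $G_5$ denote the rank-two complex reflection groups numbered 4 and 5 in the Shephard–Todd list. Let $\omega=e^{2\pi i/3}$. Concretely, $G_4\subset \mathrm{GL}_2(\mathbb{C})$ is the group of order 24 generated by $$A=\begin{bmatrix}1&0\\0&\omega\end{bmatrix},\qquad B=\begin{bmatrix}\frac{\omega-\omega^2}{3}&\omega^2\\ \frac{-2\omega^2}{3}&\frac{-\omega-2\omega^2}{3}\end{bmatrix},$$ which satisfy $A^3=B^3=I$ and $ABA=BAB$. $G_5\subset\mathrm{GL}_2(\mathbb{C})$ is the group of order 72 generated by two non-commuting reflections $A,B$ of order 3, each with eigenvalues $1,\omega$, satisfying $ABAB=BABA$ (unique up to conjugation in $\mathrm{GL}_2(\mathbb{C})$). All reflections in these groups have order 3. For a well-generated complex reflection group $W$ of rank $n$, with set of reflections $\mathcal{R}$ and set of reflecting hyperplanes $\mathcal{A}$, the Coxeter number is $h=(|\mathcal{R}|+|\mathcal{A}|)/n$ (so $h=6$ for $G_4$ and $h=12$ for $G_5$). A Coxeter element is an element of $W$ having some primitive $h$-th root of unity as an eigenvalue. A reflection factorization of $g\in W$ is a tuple $(t_1,\ldots,t_k)$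 of reflections in $W$ with $t_1t_2\cdots t_k=g$. For $1\le i\le k-1$, the $i$-th Hurwitz move $\sigma_i$ sends $(t_1,\ldots,t_k)$ to $(t_1,\ldots,t_{i-1},\,t_{i+1},\,t_{i+1}^{-1}t_it_{i+1},\,t_{i+2},\ldots,t_k)$. The Hurwitz orbit of a factorization is the set of all factorizations reachable from it by a series of Hurwitz moves. The multiset of conjugacy classes of $(t_1,\ldots,t_k)$ is the multiset of the $W$-conjugacy classes of $t_1,\ldots,t_k$. *)

(* Defs.v *)
(* The complex numbers are R[i] for R : realType. *)
From HB Require Import structures.
From Stdlib Require Import Relation_Operators.
From mathcomp Require Import all_boot all_order all_algebra.
From mathcomp Require Import finmap all_classical all_reals all_analysis.
From mathcomp Require Import complex.
Set Implicit Arguments.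
Unset Strict Implicit.
Unset Printing Implicit Defensive.
Import Order.TTheory GRing.Theory Num.Theory.

Local Open Scope classical_set_scope.
Local Open Scope ring_scope.
Local Open Scope complex_scope.

Section Reflections.

(* Dimensions are n.+1 so that square matrices form a ring. *)
Variables (F : fieldType) (n : nat).
Implicit Types (g t w A B : 'M[F]_n.+1) (W S : set 'M[F]_n.+1).
Implicit Types s u : seq 'M[F]_n.+1.

Definition is_GL_subgroup W :=
  [/\ W `<=` [set g | g \in unitmx], W 1,
      forall g w, W g -> W w -> W (g * w)
    & forall g, W g -> W g^-1].

Definition generated_group S : set 'M[F]_n.+1 := smallest is_GL_subgroup S.

(* Matrices act on column vectors. *)
Definition fix_space g : {vspace 'cV[F]_n.+1} := fixedSpace (linfun (mulmx g)).

Definition is_reflection t :=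
  (exists2 m, (0 < m)%N & t ^+ m = 1) /\ \dim (fix_space t) = n.

Definition reflections W : set 'M[F]_n.+1 := [set t | W t /\ is_reflection t].

Definition hyperplanes W : set {vspace 'cV[F]_n.+1} :=
  fix_space @` reflections W.

(* Natural-number division, exact for well-generated groups; [fset_set] is the
   empty set on infinite sets, so this is meaningful only for finite [W]. *)
Definition coxeter_number W : nat :=
  ((#|` fset_set (reflections W)| + #|` fset_set (hyperplanes W)|) %/ n.+1)%N.

Definition coxeter_element W c :=
  W c /\ exists2 z : F, (coxeter_number W).-primitive_root z & eigenvalue c z.

Definition reflection_factorization W c s :=
  (forall t, t \in s -> reflections W t) /\ \prod_(t <- s) t = c.

(* Positions are counted from 0. *)
Definition hurwitz_move (i : nat) s :=
  let a := s`_i in let b := s`_i.+1 in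
  take i s ++ [:: b; b^-1 * a * b] ++ drop i.+2 s.

Definition hurwitz_step s u :=
  exists2 i, (i.+1 < size s)%N & u = hurwitz_move i s.

Definition hurwitz_orbit s : set (seq 'M[F]_n.+1) :=
  [set u | clos_refl_trans _ hurwitz_step s u].

Definition conj_class W g : set 'M[F]_n.+1 :=
  [set w^-1 * g * w | w in W].

(* Equality of multisets of conjugacy classes is [perm_eq] of these lists. *)
Definition conj_classes W s : seq (set 'M[F]_n.+1) :=
  [seq conj_class W t | t <- s].

End Reflections.

Section G4G5.

Variable R : realType.
Local Notation C := R[i].

Definition omega : C := cos (2 * pi / 3) +i* sin (2 * pi / 3).

Definition mx2 (a b c d : C) : 'M[C]_2 :=
  \matrix_(i, j) (nth [::] [:: [:: a; b]; [:: c; d]] i)`_j.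

Definition G4_A : 'M[C]_2 := mx2 1 0 0 omega.

Definition G4_B : 'M[C]_2 :=
  mx2 ((omega - omega ^+ 2) / 3) (omega ^+ 2)
      (- 2 * omega ^+ 2 / 3) ((- omega - 2 * omega ^+ 2) / 3).

Definition G4 : set 'M[C]_2 := generated_group [set G4_A; G4_B].

Definition G5_generator (A : 'M[C]_2) :=
  [/\ is_reflection A, A ^+ 3 = 1, A != 1
    & forall z, eigenvalue A z <-> z = 1 \/ z = omega].

(* G5 is defined only up to conjugation in GL_2(C). *)
Definition is_G5 (W : set 'M[C]_2) :=
  exists A B : 'M[C]_2,
    [/\ G5_generator A, G5_generator B, A * B != B * A,
        A * B * A * B = B * A * B * A
      & W = generated_group [set A; B] /\ (W #= `I_72)%card].

End G4G5.

Arguments G4 : clear implicits.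

(* Main.v *)
Require Import Defs.
From HB Require Import structures.
From Stdlib Require Import Relation_Operators.
From mathcomp Require Import all_boot all_order all_algebra.
From mathcomp Require Import finmap.
From mathcomp Require Import all_classical all_reals all_analysis.
From mathcomp Require Import complex.
From mathcomp Require Import ring lra zify.
Set Implicit Arguments.
Unset Strict Implicit.
Unset Printing Implicit Defensive.
Import Order.TTheory GRing.Theory Num.Theory.
Local Open Scope ring_scope.

(** Up to conjugacy, G4 and G5 lie in one group of order 72: it is generated by
    two reflections a, b of order 3 with aba = bab, which generate G4, together
    with the scalar omega; G5 is generated by a and omega b^-1. Modulo scalars
    this group is the alternating group on four points, seen here as the affine
    line over F_4. Each reflection fixes one point p and turns the three others
    about it, so it is one of a_p, a_p^-1, omega^2 a_p, omega a_p^-1, where a_p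
    is the reflection of determinant omega in G4 that fixes p. It is thus a
    letter: a point p and a label, the label telling which of these four forms
    it has. Conjugation by a letter moves the point by an affine map and keeps
    the label, so the conjugacy classes in a factorization determine its labels.
    The theorem becomes a statement on words under Hurwitz moves.

    Call a word constant when all its letters have the same point. Two
    nonconstant words are Hurwitz equivalent as soon as they have the same
    product and the same multiset of labels ([braid_equiv_of_prod]). The proof
    is by induction on the length. Words of length 2 and 3 are settled by finite
    verification ([pure_braids2_suffice], [pure_braids3_suffice]). For length at
    least 4, fix a label l occurring in both words. Carrying a first letter of
    label l around the following ones gives it at least three of the four
    possible points, while the remaining word stays nonconstant
    ([can_start_three], again finite). Two sets of three points among four meet,
    so both words are equivalent to words with the same first letter and a
    nonconstant tail; that letter cancels from the products and the induction
    hypothesis applies to the tails ([common_start]).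

    It remains to see that a factorization of a Coxeter element is not constant.
    The letters with a given point commute and have order 3, so a constant word
    has a product of cube 1 and all its eigenvalues are cube roots of unity. But
    the group contains at least eight reflections, hence the Coxeter number is
    at least 4 ([coxeter_number_ge4]) and no primitive root of that order is a
    cube root of unity.

    The generators given for G4 and those allowed for G5 are matched with the
    letters through [burau_basis]: two reflections with eigenvalues 1 and
    omega whose product has trace omega form a pair that is unique up to
    simultaneous conjugation. *)

(** * Letters and braid moves *)

(** The point (a, b) is the element a + b zeta of F_4, where zeta^2 = zeta + 1. *)
Notation point := (bool * bool)%type.

Definition point_add (p q : point) : point := (p.1 (+) q.1, p.2 (+) q.2).
Definition zeta_mul (p : point) : point := (p.2, p.1 (+) p.2).

(** In the label (d, c), the boolean d gives the direction of rotation about the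
    point and c is a colour. Conjugation never looks at colours, so their type is
    left free: two colours describe the reflections of the groups, and strand
    numbers used as colours follow the strands of a braid. *)
Notation letter T := (point * (bool * T))%type.

Section Words.
Variable T : eqType.
Implicit Types (x y : letter T) (u v w : seq (letter T)) (b : seq nat).

(** This is y^-1 x y: the letter y acts on points as multiplication by zeta or
    zeta^2 on the affine line over F_4 with origin at the point of y. *)
Definition conj_letter x y : letter T :=
  let d := point_add x.1 y.1 in
  (point_add y.1 (if y.2.1 then zeta_mul (zeta_mul d) else zeta_mul d), x.2).

Arguments conj_letter : simpl never.

Definition inv_letter x : letter T := (x.1, (~~ x.2.1, x.2.2)).

Definition nonconstant w := ~~ constant (unzip1 w).

Fixpoint braid_move (i : nat) w : seq (letter T) :=
  match i, w with
  | 0%N, x :: y :: v => y :: conj_letter x y :: v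
  | j.+1, x :: v => x :: braid_move j v
  | _, _ => w
  end.

Definition braid b w := foldl (fun v i => braid_move i v) w b.

(** Hurwitz moves are not inverted here: they have finite order, so the relation
    is symmetric all the same. *)
Definition braid_equiv w v := exists b, braid b w = v.

Lemma conj_letter_same x y : x.1 = y.1 -> conj_letter x y = x.
Proof. by case: x y => [[[] []] l] [[[] []] [[] m]]. Qed.

Lemma conj_letter_invK x y : conj_letter (conj_letter x (inv_letter y)) y = x.
Proof. by case: x y => [[[] []] l] [[[] []] [[] m]]. Qed.

(** Two successive moves at one place conjugate both letters by their product,
    whose action on the points has order 1, 2 or 3. *)
Lemma braid_move_order i w : iter 12 (braid_move i) w = w.
Proof.
elim: i w => [|i IH] [|x w]; try by rewrite iter_fix.
  case: w => [|y w]; first by rewrite iter_fix.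
  by case: x y => [[[] []] [[] c]] [[[] []] [[] d]].
suff iterS n : iter n (braid_move i.+1) (x :: w) = x :: iter n (braid_move i) w.
  by rewrite iterS IH.
by elim: n => //= n ->.
Qed.

Lemma braid_cat b c w : braid (b ++ c) w = braid c (braid b w).
Proof. exact: foldl_cat. Qed.

Lemma braid_cons b x w : braid (map S b) (x :: w) = x :: braid b w.
Proof. by elim: b w => [|i b IH] w //=; rewrite /braid /= -IH. Qed.

Lemma size_braid_move i w : size (braid_move i w) = size w.
Proof. by elim: i w => [|i IH] [|x [|y w]] //=; rewrite IH. Qed.

Lemma braid_move_catl i w v : (i.+1 < size w)%N ->
  braid_move i (w ++ v) = braid_move i w ++ v.
Proof.
elim: i w => [|i IH] [|x [|y w]] // lt_i.
by have /= -> := IH (y :: w) lt_i.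
Qed.

Lemma braid_catl b w v :
  all (fun i => i.+1 < size w)%N b -> braid b (w ++ v) = braid b w ++ v.
Proof.
elim: b w => [|i b IH] w //= /andP[lt_i lt_b].
rewrite /braid /= braid_move_catl // -IH //.
by apply: sub_all lt_b => j; rewrite size_braid_move.
Qed.

Lemma braid_equiv_refl w : braid_equiv w w.
Proof. by exists [::]. Qed.

Lemma braid_equiv_trans v u w :
  braid_equiv u v -> braid_equiv v w -> braid_equiv u w.
Proof. by move=> [b <-] [c <-]; exists (b ++ c); rewrite braid_cat. Qed.

Lemma braid_equiv_sym u w : braid_equiv u w -> braid_equiv w u.
Proof.
case=> b <-; elim: b u => [|i b IH] u; first exact: braid_equiv_refl.
(* The inverse of a move of order 12 is its eleventh power. *)
apply: braid_equiv_trans (IH _) _; exists (nseq 11 i).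
exact: (braid_move_order i u).
Qed.

Lemma braid_equiv_cons x u w : braid_equiv u w -> braid_equiv (x :: u) (x :: w).
Proof. by case=> b <-; exists (map S b); rewrite braid_cons. Qed.

Lemma perm_braid_move i w : perm_eq (unzip2 (braid_move i w)) (unzip2 w).
Proof.
elim: i w => [|i IH] [|x w] //=; last by rewrite perm_cons IH.
case: w => [|y w] //=.
exact: (permEl (perm_catCA [:: y.2] [:: x.2] (unzip2 w))).
Qed.

Lemma braid_equiv_perm u w : braid_equiv u w -> perm_eq (unzip2 u) (unzip2 w).
Proof.
case=> b <-; elim: b u => [|i b IH] u //.
by rewrite -(permPl (perm_braid_move i u)); apply: IH.
Qed.

Lemma constant_all (s : seq point) :
  reflect (exists p, all (pred1 p) s) (constant s).
Proof.
case: s => [|p s] /=; first by apply: ReflectT; exists (false, false).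
apply: (iffP idP) => [ps|[q /andP[/eqP-> //]]].
by exists p; rewrite eqxx.
Qed.

Lemma braid_equiv_constant u w : braid_equiv u w ->
  constant (unzip1 u) -> constant (unzip1 w).
Proof.
case=> b <-; elim: b u => [|i b IH] u // /constant_all[p pu].
apply: IH; apply/constant_all; exists p.
elim: i u pu => [|i IH] [|x u] //=; last by case/andP=> -> /IH.
case: u => [|y u] //= /and3P[/eqP xp /eqP yp ->].
have /(congr1 fst)/= -> := conj_letter_same (etrans xp (esym yp)).
by rewrite xp yp eqxx.
Qed.

Lemma braid_equiv_nonconstant u w :
  braid_equiv u w -> nonconstant u -> nonconstant w.
Proof. by move=> /braid_equiv_sym uw; apply/contra/braid_equiv_constant. Qed.

(** A letter travels to the left unchanged, since a move conjugates only the
    letter that passes to the right. *)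
Lemma braid_equiv_front u x v :
  braid_equiv (u ++ x :: v) (x :: map (conj_letter^~ x) u ++ v).
Proof.
elim: u => [|y u IH] /=; first exact: braid_equiv_refl.
by apply: braid_equiv_trans (braid_equiv_cons y IH) _; exists [:: 0%N].
Qed.

Lemma braid_equiv_mem x w : x \in w -> exists u, braid_equiv w (x :: u).
Proof.
case/splitPr=> u v; exists (map (conj_letter^~ x) u ++ v).
exact: braid_equiv_front.
Qed.

Lemma braid_equiv_labels w s : perm_eq (unzip2 w) s ->
  exists2 v, braid_equiv w v & unzip2 v = s.
Proof.
elim: s w => [|l s IH] w ws.
  exists w; first exact: braid_equiv_refl.
  exact/perm_nilP.
have /mapP[x /braid_equiv_mem[u wu] lx]: l \in unzip2 w.
  by rewrite (perm_mem ws) mem_head.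
have /IH[v uv vs]: perm_eq (unzip2 u) s.
  rewrite -(perm_cons l) -(permPr ws) perm_sym lx.
  exact: braid_equiv_perm wu.
exists (x :: v); last by rewrite /= vs lx.
exact/(braid_equiv_trans wu)/braid_equiv_cons.
Qed.

Lemma front_pair w l : nonconstant w -> l \in unzip2 w ->
  exists x y u, [/\ braid_equiv w [:: x, y & u], x.2 = l & x.1 != y.1].
Proof.
move=> w_nc /mapP[x /braid_equiv_mem[u wu] ->].
have := braid_equiv_nonconstant wu w_nc; rewrite /nonconstant /= -has_predC.
case/hasP=> q /mapP[y /braid_equiv_mem[v uv] ->] yx.
exists x, y, v; split=> //; last by rewrite eq_sym.
exact/(braid_equiv_trans wu)/braid_equiv_cons.
Qed.

End Words.

(** * Finite verifications on short words *)

Definition recolor (T U : eqType) (f : T -> U) (x : letter T) : letter U :=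
  (x.1, (x.2.1, f x.2.2)).

(** This transfers to arbitrary colours what is verified with strand numbers as
    colours. *)
Lemma braid_recolor (T U : eqType) (f : T -> U) b w :
  braid b (map (recolor f) w) = map (recolor f) (braid b w).
Proof.
elim: b w => [|i b IH] w //; rewrite /braid /= -IH; congr foldl.
elim: i w {b IH} => [|i IH] [|x w] //=; last by rewrite IH.
by case: w.
Qed.

Lemma unzip1_recolor (T U : eqType) (f : T -> U) w :
  unzip1 (map (recolor f) w) = unzip1 w.
Proof. by rewrite /unzip1 -map_comp. Qed.

Definition bools := [:: false; true].
Definition points : seq point := [seq (a, b) | a <- bools, b <- bools].

Lemma mem_bools b : b \in bools. Proof. by case: b. Qed.
Lemma mem_points p : p \in points. Proof. by case: p => [[] []]. Qed.

Fixpoint tuples (T : Type) (s : seq T) n : seq (seq T) :=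
  if n is m.+1 then [seq x :: w | x <- s, w <- tuples s m] else [:: [::]].

Lemma mem_tuples (T : eqType) (s w : seq T) :
  {subset w <= s} -> w \in tuples s (size w).
Proof.
elim: w => [|x w IH] //= ws; apply/allpairsP; exists (x, w); split=> //=.
  by apply: ws; rewrite mem_head.
by apply: IH => y yw; apply: ws; rewrite inE yw orbT.
Qed.

Definition strands (ps : seq point) (ds : seq bool) : seq (letter nat) :=
  zip ps (zip ds (iota 0 (size ds))).

(** The pure braid that carries the first strand once around the next k. *)
Definition loop (k : nat) : seq nat := iota 0 k ++ rev (iota 0 k).
Definition two_loops :=
  let ls := [:: [::]; loop 1; loop 2; loop 3] in [seq c ++ d | c <- ls, d <- ls].

(** The strand number is part of the label, so the letter brought to the front is
    the first one with its point changed. *)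
Definition can_start (w : seq (letter nat)) (p : point) : bool :=
  has (fun v => if v is x :: u
                then [&& x.1 == p, x.2 == (head x w).2 & nonconstant u] else false)
      [seq braid b w | b <- two_loops].

Definition three_can_start :=
  all (fun ds => all (fun ps =>
      (nth (false, false) ps 0 == nth (false, false) ps 1) ||
      (2 < count (can_start (strands ps ds)) points)%N)
    (tuples points 4)) (tuples bools 4).

(** Products are computed with matrices over the Eisenstein integers; the pair
    (a, b) is a + b omega. *)
Definition eis : Type := (int * int)%type.
Definition eadd (x y : eis) : eis := (x.1 + y.1, x.2 + y.2).
Definition emul (x y : eis) : eis :=
  (x.1 * y.1 - x.2 * y.2, x.1 * y.2 + x.2 * y.1 - x.2 * y.2).
Definition emx : Type := (eis * eis * eis * eis)%type.
Definition emx_mul (m n : emx) : emx :=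
  let: (a, b, c, d) := m in let: (a', b', c', d') := n in
  (eadd (emul a a') (emul b c'), eadd (emul a b') (emul b d'),
   eadd (emul c a') (emul d c'), eadd (emul c b') (emul d d')).
Definition emx_scale (k : eis) (m : emx) : emx :=
  let: (a, b, c, d) := m in (emul k a, emul k b, emul k c, emul k d).
Definition emx1 : emx := ((1, 0), (0, 0), (0, 0), (1, 0)).

(** The reduced Burau matrices of the two generators of the three-strand braid
    group, at t = - omega: a model of G4 with Eisenstein integer entries. *)
Definition burau1 : emx := ((0, 1), (1, 0), (0, 0), (1, 0)).
Definition burau2 : emx := ((1, 0), (0, 0), (0, -1), (0, 1)).

(** The last two matrices are conjugates of the first two, with points as
    prescribed by [conj_letter]. *)
Definition point_mx (p : point) : emx :=
  match p with
  | (false, false) => burau1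
  | (true, false) => burau2
  | (false, true) => emx_mul (emx_mul burau1 burau1) (emx_mul burau2 burau1)
  | (true, true) => emx_mul (emx_mul burau2 burau2) (emx_mul burau1 burau2)
  end.
Definition direction_mx (p : point) (d : bool) : emx :=
  if d then emx_mul (point_mx p) (point_mx p) else point_mx p.

Definition emx_word ps ds :=
  foldr emx_mul emx1 [seq direction_mx x.1 x.2 | x <- zip ps ds].

(** The strand numbers make the braids found here pure, and directions alone fix
    the product up to a scalar; so colours need not be enumerated. *)
Definition pure_braids_suffice n (bs : seq (seq nat)) :=
  all (fun ds =>
    let ws := [seq (strands ps ds, emx_word ps ds)
              | ps <- tuples points n & ~~ constant ps] in
    all (fun w =>
      let vs := [seq braid b w.1 | b <- bs] in
      all (fun w' => if w.2 == w'.2 then w'.1 \in vs else true) ws) ws)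
  (tuples bools n).

Definition pure_braids2 : seq (seq nat) :=
  [seq flatten c | c <- tuples [:: [::]; loop 1] 2].

(** The three nonempty braids generate the pure braid group on three strands. *)
Definition pure_braids3 : seq (seq nat) :=
  [seq flatten c | c <- tuples [:: [::]; loop 1; loop 2; [:: 1; 1]%N] 3].

Section Checks.
Variable T : eqType.
Implicit Types (x y : letter T) (u v w : seq (letter T)).

Definition dirs w := unzip1 (unzip2 w).
Definition colors w := unzip2 (unzip2 w).

Lemma strandsK c w :
  map (recolor (nth c (colors w))) (strands (unzip1 w) (dirs w)) = w.
Proof.
rewrite /strands; set f := nth c _.
have: forall i, (i < size w)%N -> f (0 + i)%N = nth c (colors w) i by [].
move: f 0%N => g; elim: w => [|x w IH] k //= gE; congr (_ :: _).
  rewrite /recolor /= -[k]addn0 gE //.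
  by case: x {gE} => p [d e].
rewrite !size_map in IH *.
by apply: IH => i lt_i; rewrite addSnnS gE.
Qed.

Lemma nonconstant_catl u v : nonconstant u -> nonconstant (u ++ v).
Proof.
rewrite /nonconstant /unzip1 map_cat; apply: contra.
case/constant_all=> p; rewrite all_cat => /andP[up _].
by apply/constant_all; exists p.
Qed.

Lemma mem_unzip1 w : unzip1 w \in tuples points (size w).
Proof.
by rewrite -(size_map fst w); apply/mem_tuples => p _; apply: mem_points.
Qed.

Lemma mem_dirs w : dirs w \in tuples bools (size w).
Proof.
rewrite -(size_map snd w) -(size_map fst (unzip2 w)).
by apply/mem_tuples => d _; apply: mem_bools.
Qed.

(** Carried around a block of letters, the first letter is conjugated by its
    product with the block; at most two turns, around blocks of one, two or
    three letters, give enough such products. *)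
Lemma can_start_three : three_can_start.
Proof. by vm_compute. Qed.

Lemma can_start_equiv x w v p :
  can_start (strands (unzip1 (x :: w)) (dirs (x :: w))) p -> size w = 3 ->
  exists2 u, braid_equiv (x :: w ++ v) ((p, x.2) :: u) & nonconstant u.
Proof.
set s := strands _ _ => /hasP[s' /mapP[b b_in ->]] bs sz.
have b_small: all (fun i => i.+1 < size (x :: w))%N b.
  by rewrite /= sz; apply: (allP _ _ b_in); vm_compute.
have := braid_catl v b_small.
rewrite -(strandsK x.2.2 (x :: w)) braid_recolor -/s.
case: (braid b s) bs => // q u /and3P[/eqP qp /eqP qx u_nc] bE.
exists (map (recolor (nth x.2.2 (colors (x :: w)))) u ++ v).
  exists b; rewrite -cat_cons -{1}(strandsK x.2.2 (x :: w)) bE /=.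
  congr (_ :: _).
  by rewrite /recolor qp qx /=; case: (x) => ? [].
by apply: nonconstant_catl; rewrite /nonconstant unzip1_recolor.
Qed.

(** Each of the two words can start with at least three of the four points, so
    some point serves both. *)
Lemma common_start x y w x' y' w' v v' :
    x.1 != y.1 -> x'.1 != y'.1 -> x.2 = x'.2 -> size w = 2 -> size w' = 2 ->
  exists p u u', [/\ braid_equiv [:: x, y & w ++ v] ((p, x.2) :: u),
    braid_equiv [:: x', y' & w' ++ v'] ((p, x.2) :: u'),
    nonconstant u & nonconstant u'].
Proof.
move=> xy xy' xx' sz sz'.
pose good (z t : letter T) r :=
  can_start (strands (unzip1 [:: z, t & r]) (dirs [:: z, t & r])).
have cnt z t r : size r = 2 -> z.1 != t.1 -> (2 < count (good z t r) points)%N.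
  move=> sr zt; have := can_start_three.
  have pts := mem_unzip1 [:: z, t & r]; have ds := mem_dirs [:: z, t & r].
  rewrite /= sr in pts ds.
  by move/allP/(_ _ ds)/allP/(_ _ pts); rewrite [_ == _](negPf zt).
have: has (predI (good x y w) (good x' y' w')) points.
  rewrite has_count.
  rewrite -(ltn_add2l (count (predU (good x y w) (good x' y' w')) points)).
  rewrite count_predUI addn0.
  apply: leq_ltn_trans (count_size _ _) _.
  exact: leq_add (ltnW (cnt _ _ _ sz xy)) (cnt _ _ _ sz' xy').
case/hasP=> p _ /andP[g g'].
have [u] := can_start_equiv v g (congr1 S sz).
have [u'] := can_start_equiv v' g' (congr1 S sz').
by exists p, u, u'; rewrite {2}xx'.
Qed.

Lemma pure_braids_equiv n bs w w' : pure_braids_suffice n bs ->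
  size w = n -> size w' = n -> unzip2 w = unzip2 w' ->
  nonconstant w -> nonconstant w' ->
  emx_word (unzip1 w) (dirs w) = emx_word (unzip1 w') (dirs w) ->
  braid_equiv w w'.
Proof.
move=> chk sz sz' ww' w_nc w'_nc prodE.
have dE: dirs w' = dirs w by rewrite /dirs ww'.
have cE: colors w' = colors w by rewrite /colors ww'.
have c: T by case: (w) w_nc => // x _ _; exact: x.2.2.
have ds := mem_dirs w; rewrite sz in ds.
have mem_ws v : size v = n -> nonconstant v ->
    (strands (unzip1 v) (dirs w), emx_word (unzip1 v) (dirs w)) \in
    [seq (strands ps (dirs w), emx_word ps (dirs w))
    | ps <- tuples points n & ~~ constant ps].
  move=> sv v_nc; apply/mapP; exists (unzip1 v) => //.
  rewrite mem_filter -[~~ _]/(nonconstant v) v_nc /=.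
  by rewrite -sv mem_unzip1.
have := allP (allP (allP chk _ ds) _ (mem_ws _ sz w_nc)) _ (mem_ws _ sz' w'_nc).
rewrite /= prodE eqxx => /mapP[b _ bE].
exists b; rewrite -(strandsK c w) braid_recolor -bE -[RHS](strandsK c w').
by rewrite dE cE.
Qed.

End Checks.

Lemma pure_braids2_suffice : pure_braids_suffice 2 pure_braids2.
Proof. by vm_compute. Qed.

Lemma pure_braids3_suffice : pure_braids_suffice 3 pure_braids3.
Proof. by vm_compute. Qed.

(** * Nonconstant words are classified by product and labels *)

Section Products.
Variables (T : eqType) (G : unitRingType) (rho : letter T -> G).
Implicit Types (x y : letter T) (u v w : seq (letter T)).
Hypothesis rho_unit : forall x, rho x \is a GRing.unit.
Hypothesis rho_conj : forall x y, rho x * rho y = rho y * rho (conj_letter x y).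

Lemma size_labels w : size (unzip2 w) = size w. Proof. exact: size_map. Qed.

Lemma braid_equiv_prod u w :
  braid_equiv u w -> \prod_(x <- u) rho x = \prod_(x <- w) rho x.
Proof.
case=> b <-; elim: b u => [|i b IH] u //.
rewrite -[RHS]IH; elim: i u {b IH} => [|i IH] [|x u] //.
  by case: u => [|y u] //; rewrite !big_cons !mulrA rho_conj.
by rewrite !big_cons IH.
Qed.

(** Both directions of the conjugation are required, which makes closure under
    inverses immediate. *)
Definition preserves_labels (g : G) : Prop :=
  g \is a GRing.unit /\ forall x,
    (exists2 y, y.2 = x.2 & rho x * g = g * rho y) /\
    (exists2 y, y.2 = x.2 & g * rho x = rho y * g).

Lemma preserves_labels1 : preserves_labels 1.
Proof.
split=> [|x]; first by rewrite unitr1.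
by split; exists x; rewrite // mul1r mulr1.
Qed.

Lemma preserves_labelsM g h :
  preserves_labels g -> preserves_labels h -> preserves_labels (g * h).
Proof.
move=> [gU gH] [hU hH]; split=> [|x]; first by rewrite unitrMl.
split.
  have [[y yx E1] _] := gH x; have [[z zy E2] _] := hH y.
  by exists z; rewrite ?zy // mulrA E1 -mulrA E2 mulrA.
have [_ [y yx E1]] := hH x; have [_ [z zy E2]] := gH y.
by exists z; rewrite ?zy // -mulrA E1 mulrA E2 mulrA.
Qed.

Lemma preserves_labelsV g : preserves_labels g -> preserves_labels g^-1.
Proof.
move=> [gU gH]; split=> [|x]; first by rewrite unitrV.
have [[y yx E1] [z zx E2]] := gH x; split.
  by exists z => //; apply: (mulrI gU); rewrite mulrA E2 mulrK // mulVKr.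
by exists y => //; apply: (mulrI gU); rewrite mulVKr // mulrA -E1 mulrK.
Qed.

Lemma preserves_labels_rho x : preserves_labels (rho x).
Proof.
split=> [|y]; first exact: rho_unit.
split; first by exists (conj_letter y x); [by [] | apply: rho_conj].
exists (conj_letter y (inv_letter x)); first by [].
by rewrite (rho_conj _ x) conj_letter_invK.
Qed.

Lemma preserves_labels_conj g x y : preserves_labels g -> injective rho ->
  g^-1 * rho x * g = rho y -> x.2 = y.2.
Proof.
move=> [gU gH] inj; have [[z zx E] _] := gH x.
by rewrite -mulrA E mulKr // => /inj <-.
Qed.

(** Colours act through scalars, which cancel between words with the same labels;
    this is why the products of the model may leave them out. *)
Hypothesis rho_faithful : forall u w, unzip2 u = unzip2 w ->
  \prod_(x <- u) rho x = \prod_(x <- w) rho x ->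
  emx_word (unzip1 u) (dirs u) = emx_word (unzip1 w) (dirs w).

(** In length at most 3 the second word is first rearranged to have the labels
    of the first one in the same order, so that pure braids suffice. In greater
    length a common first letter is split off. *)
Lemma braid_equiv_of_prod u w : nonconstant u -> nonconstant w ->
  perm_eq (unzip2 u) (unzip2 w) ->
  \prod_(x <- u) rho x = \prod_(x <- w) rho x -> braid_equiv u w.
Proof.
have [n] := ubnP (size u); elim: n u w => // n IH u w lt_n u_nc w_nc uw prod_uw.
have su : size u = size w by rewrite -size_labels (perm_size uw) size_labels.
have [u_le3 | u_ge4] := leqP (size u) 3.
  have [v wv vE] := braid_equiv_labels (etrans (perm_sym _ _) uw).
  apply: braid_equiv_trans (braid_equiv_sym wv).
  have v_nc := braid_equiv_nonconstant wv w_nc.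
  have sv : size v = size u by rewrite -size_labels vE size_labels.
  have prod_uv : emx_word (unzip1 u) (dirs u) = emx_word (unzip1 v) (dirs u).
    have dE : dirs u = dirs v by rewrite /dirs vE.
    rewrite [in RHS]dE; apply: rho_faithful; first by rewrite vE.
    by rewrite prod_uw; apply: braid_equiv_prod.
  have sz : size u \in [:: 2; 3]%N.
    by case: (u) u_le3 u_nc => [|? [|? [|? [|? ?]]]].
  have bs : exists bs, pure_braids_suffice (size u) bs.
    move: sz; rewrite !inE => /orP[] /eqP->.
      by exists pure_braids2; apply: pure_braids2_suffice.
    by exists pure_braids3; apply: pure_braids3_suffice.
  by case: bs => bs /pure_braids_equiv; apply.
case: u => [|x0 u0] // in lt_n u_nc uw prod_uw su u_ge4 *.
set u := x0 :: u0 in lt_n u_nc uw prod_uw su u_ge4 *.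
have lu : x0.2 \in unzip2 u by rewrite mem_head.
have lw : x0.2 \in unzip2 w by rewrite -(perm_mem uw).
have [x [y [u1 [uu1 xl xy]]]] := front_pair u_nc lu.
have [x' [y' [w1 [ww1 xl' xy']]]] := front_pair w_nc lw.
have size_equiv (v1 v2 : seq (letter T)) : braid_equiv v1 v2 -> size v1 = size v2.
  by move/braid_equiv_perm/perm_size; rewrite !size_labels.
have su1 := size_equiv _ _ uu1; have sw1 := size_equiv _ _ ww1.
have u1_ge2 : (1 < size u1)%N by move: u_ge4; rewrite su1.
have w1_ge2 : (1 < size w1)%N by move: u_ge4; rewrite su sw1.
have split2 (v : seq (letter T)) : (1 < size v)%N ->
    exists v1 v2, v = v1 ++ v2 /\ size v1 = 2.
  by move=> lt_v; exists (take 2 v), (drop 2 v); rewrite cat_take_drop size_takel.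
have [u2 [v2 [u1E su2]]] := split2 u1 u1_ge2.
have [w2 [v2' [w1E sw2]]] := split2 w1 w1_ge2.
have := common_start v2 v2' xy xy' (etrans xl (esym xl')) su2 sw2.
rewrite -u1E -w1E => -[p [u3 [w3 [uu3 ww3 u3_nc w3_nc]]]].
have {uu1}uu3 := braid_equiv_trans uu1 uu3.
have {ww1}ww3 := braid_equiv_trans ww1 ww3.
apply: (braid_equiv_trans uu3).
apply: (braid_equiv_trans _ (braid_equiv_sym ww3)).
apply: braid_equiv_cons.
apply: IH => //.
- by move: lt_n; rewrite ltnS (size_equiv _ _ uu3).
- rewrite -(perm_cons x.2) -[x.2 :: unzip2 u3]/(unzip2 ((p, x.2) :: u3)).
  rewrite -(permPl (braid_equiv_perm uu3)) (permPl uw); exact: braid_equiv_perm ww3.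
- apply: (mulrI (rho_unit (p, x.2))).
  by move: prod_uw; rewrite (braid_equiv_prod uu3) (braid_equiv_prod ww3) !big_cons.
Qed.

End Products.

(** * The model of order 72 over the Eisenstein integers *)

(** The eigenvalues of a_p are 1 and omega, those of omega^2 a_p are omega^2
    and 1: the cube root of unity is the one that gives a reflection again. *)
Definition color_unit (d c : bool) : eis :=
  if c then (if d then (0, 1) else (-1, -1)) else (1, 0).
Definition letter_mx (x : letter bool) : emx :=
  emx_scale (color_unit x.2.1 x.2.2) (direction_mx x.1 x.2.1).
Definition letters : seq (letter bool) :=
  [seq (p, l) | p <- points, l <- points].
Lemma mem_letters x : x \in letters.
Proof. by case: x => p l; apply: allpairs_f; apply: mem_points. Qed.

Definition emx_det (m : emx) : eis := let: (a, b, c, d) := m in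
  eadd (emul a d) (emul (-1, 0) (emul b c)).
Definition emx_tr (m : emx) : eis := let: (a, b, c, d) := m in eadd a d.

Definition grow (s : seq emx) : seq emx :=
  undup (s ++ [seq emx_mul g m | m <- s, g <- [:: burau1; burau2]]).

(** Words of length at most 6 in the two generators exhaust the group. *)
Definition G4_elements : seq emx := iter 6 grow [:: emx1].
Definition G5_elements : seq emx :=
  [seq emx_scale k g
  | k <- [:: (1, 0); (0, 1); (-1, -1)] : seq eis, g <- G4_elements].

Lemma letter_mx_conj x y : emx_mul (letter_mx x) (letter_mx y) =
  emx_mul (letter_mx y) (letter_mx (conj_letter x y)).
Proof.
have: all (fun x => all (fun y => emx_mul (letter_mx x) (letter_mx y) ==
    emx_mul (letter_mx y) (letter_mx (conj_letter x y))) letters) letters.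
  by vm_compute.
by move/allP/(_ _ (mem_letters x))/allP/(_ _ (mem_letters y))/eqP.
Qed.

Lemma letter_mx_inv x : emx_mul (letter_mx x) (letter_mx (inv_letter x)) = emx1.
Proof. by apply/eqP; case: x => [[[] []] [[] []]]. Qed.

Lemma letter_mx_sq x :
  emx_mul (letter_mx x) (letter_mx x) = letter_mx (inv_letter x).
Proof. by apply/eqP; case: x => [[[] []] [[] []]]. Qed.

Lemma letter_mx_refl x :
  emx_tr (letter_mx x) = eadd (1, 0) (emx_det (letter_mx x)).
Proof. by apply/eqP; case: x => [[[] []] [[] []]]. Qed.

Lemma letter_mx_neq1 x : letter_mx x != emx1.
Proof. by case: x => [[[] []] [[] []]]. Qed.

Lemma letter_mx_inj : injective letter_mx.
Proof.
move=> x y xy; have: all (fun x => all (fun y =>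
  (letter_mx x == letter_mx y) == (x == y)) letters) letters by vm_compute.
move/allP/(_ _ (mem_letters x))/allP/(_ _ (mem_letters y)); rewrite xy eqxx.
by move/eqP/esym/eqP.
Qed.

Lemma G5_elements_closed g x : g \in G5_elements ->
  emx_mul g (letter_mx x) \in G5_elements.
Proof.
move=> gG; have: all (fun g => all (fun x =>
    emx_mul g (letter_mx x) \in G5_elements) letters) G5_elements.
  by vm_compute.
by move/allP/(_ _ gG)/allP/(_ _ (mem_letters x)).
Qed.

(** A matrix g of size 2 has the eigenvalue 1 exactly when
    det (g - 1) = 1 - tr g + det g vanishes. *)
Lemma G5_reflections g : g \in G5_elements ->
  g != emx1 -> emx_tr g = eadd (1, 0) (emx_det g) -> exists x, g = letter_mx x.
Proof.
move=> gG g1 gr.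
have: all (fun g => [|| g == emx1, emx_tr g != eadd (1, 0) (emx_det g) |
    g \in map letter_mx letters]) G5_elements.
  by vm_compute.
move/allP/(_ _ gG) => {gG} /or3P[gE | rE | /mapP[x _ ->]]; last by exists x.
  by rewrite gE in g1.
by move/eqP: rE; rewrite gr.
Qed.

(** * From Eisenstein integers to complex matrices *)

Section Eval.
Variable R : realType.
Local Notation C := R[i].
Local Notation w := (omega R).

(** The triple angle formula, at an angle whose triple is 2 pi, gives
    (c - 1) (2 c + 1)^2 = 0 for the cosine c, and c = 1 would make the sine vanish. *)
Lemma cos_2pi3 : cos (2 * pi / 3 : R) = - 1 / 2.
Proof.
set t : R := 2 * pi / 3.
have t3 : t + (t + t) = pi *+ 2 by rewrite /t; field.
have pi_gt0 : 0 < pi :> R := pi_gt0 R.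
have s_gt0 : 0 < sin t by apply: sin_gt0_pi; rewrite /t; apply/andP; split; lra.
have := cos2pi R; rewrite -t3 !cosD sinD.
have s2 := sin2cos2 t; set c := cos t in s2 *; set s := sin t in s2 s_gt0 *.
move=> E.
have : (c - 1) * (2 * c + 1) ^+ 2 = 0.
  have -> : (c - 1) * (2 * c + 1) ^+ 2 =
     (c * (c * c - s * s) - s * (s * c + c * s)) - 1 +
     3 * c * (s ^+ 2 - (1 - c ^+ 2)) by ring.
  by rewrite E s2; ring.
move/eqP; rewrite mulf_eq0 expf_eq0 /= => /orP[/eqP c1|/eqP c2]; last by lra.
have : s ^+ 2 = 0 by rewrite s2 (_ : c = 1); [ring | lra].
by move/eqP; rewrite expf_eq0 /= gt_eqF.
Qed.

Lemma omega_sq : w ^+ 2 = - 1 - w.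
Proof.
have c2 := cos_2pi3; have s2 := sin2cos2 (2 * pi / 3 : R).
rewrite /omega; set c := cos _ in c2 s2 *; set s := sin _ in s2 *.
rewrite expr2; apply/eqP; rewrite eq_complex /= -(expr2 s) s2 c2.
by apply/andP; split; apply/eqP; field.
Qed.

Lemma omega_neq0 : w != 0.
Proof.
apply/eqP=> w0; have := omega_sq; rewrite w0 expr0n subr0 /= => /eqP.
by rewrite eq_sym oppr_eq0 oner_eq0.
Qed.

Definition eis_eval (x : eis) : C := x.1%:~R + x.2%:~R * w.
Definition emx_eval (m : emx) : 'M[C]_2 :=
  let: (a, b, c, d) := m in
  mx2 (eis_eval a) (eis_eval b) (eis_eval c) (eis_eval d).

Lemma eis_evalD x y : eis_eval (eadd x y) = eis_eval x + eis_eval y.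
Proof. by rewrite /eis_eval /= !rmorphD /=; ring. Qed.

Lemma eis_evalM x y : eis_eval (emul x y) = eis_eval x * eis_eval y.
Proof.
rewrite /eis_eval /= !rmorphB !rmorphD !rmorphM /=.
set a := _%:~R; set b := _%:~R; set c := _%:~R; set d := _%:~R.
have -> : (a + c * w) * (b + d * w) =
  a * b + (a * d + c * b) * w + c * d * w ^+ 2 by ring.
rewrite omega_sq; ring.
Qed.

(** A relation p + q omega = 0 between integers forces the norm p^2 - p q + q^2
    to be 0. *)
Lemma eis_eval_inj : injective eis_eval.
Proof.
move=> [a b] [a' b']; rewrite /eis_eval /= => E.
have {E}E : (a - a')%:~R + (b - b')%:~R * w = 0.
  rewrite !rmorphB /= mulrBl addrACA -opprD.
  by apply/eqP; rewrite subr_eq0; apply/eqP.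
have : ((a - a') ^+ 2 - (a - a') * (b - b') + (b - b') ^+ 2)%:~R = 0 :> C.
  rewrite !expr2 rmorphD rmorphB !rmorphM /=.
  set p := _%:~R in E *; set q := _%:~R in E *.
  have -> : p = - (q * w) by apply/eqP; rewrite -addr_eq0; apply/eqP.
  transitivity (q ^+ 2 * (w ^+ 2 + w + 1)); first by ring.
  by rewrite omega_sq; ring.
move/eqP; rewrite intr_eq0 => /eqP.
set p := a - a'; set q := b - b'; move=> pq.
have [p0 q0] : p = 0 /\ q = 0 by split; nia.
by congr (_, _); apply/eqP; rewrite -subr_eq0; apply/eqP.
Qed.

End Eval.

(** * Pairs of plane reflections *)

Section Mx2.
Variable R : realType.
Local Notation C := R[i].
Local Notation w := (omega R).
Implicit Types (a b c d : C) (X Y P : 'M[C]_2).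

Lemma mx2_eta X : X = mx2 (X 0 0) (X 0 1) (X 1 0) (X 1 1).
Proof.
apply/matrixP => i j; rewrite !mxE.
by case: i => -[|[|//]] i; case: j => -[|[|//]] j /=; congr (X _ _); apply/val_inj.
Qed.

Lemma mx2_inj a b c d a' b' c' d' : mx2 a b c d = mx2 a' b' c' d' ->
  [/\ a = a', b = b', c = c' & d = d'].
Proof.
move/matrixP=> E.
by move: (E 0 0) (E 0 1) (E 1 0) (E 1 1); rewrite !mxE /=.
Qed.

Lemma mx2M a b c d a' b' c' d' : mx2 a b c d *m mx2 a' b' c' d' =
  mx2 (a * a' + b * c') (a * b' + b * d') (c * a' + d * c') (c * b' + d * d').
Proof.
rewrite [LHS]mx2_eta.
by congr mx2; rewrite !mxE !big_ord_recl big_ord0 addr0 !mxE.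
Qed.

Lemma mx2D a b c d a' b' c' d' :
  mx2 a b c d + mx2 a' b' c' d' = mx2 (a + a') (b + b') (c + c') (d + d').
Proof. by rewrite [LHS]mx2_eta; congr mx2; rewrite !mxE. Qed.

Lemma mx2Z k a b c d : k *: mx2 a b c d = mx2 (k * a) (k * b) (k * c) (k * d).
Proof. by rewrite [LHS]mx2_eta; congr mx2; rewrite !mxE. Qed.

Lemma mx2_scalar a : a%:M = mx2 a 0 0 a.
Proof. by rewrite [LHS]mx2_eta; congr mx2; rewrite !mxE. Qed.

Lemma mx2_det a b c d : \det (mx2 a b c d) = a * d - b * c.
Proof.
rewrite (expand_det_row _ 0) !big_ord_recl big_ord0 addr0 /cofactor !det_mx11.
by rewrite !mxE /= expr0 expr1 mul1r mulN1r mulrN.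
Qed.

Lemma mx2_tr a b c d : \tr (mx2 a b c d) = a + d.
Proof. by rewrite /mxtrace !big_ord_recl big_ord0 addr0 !mxE. Qed.

Lemma cayley_hamilton2 X : X *m X = \tr X *: X - (\det X)%:M.
Proof.
rewrite [X]mx2_eta !(mx2M, mx2_det, mx2_tr, mx2_scalar, mx2Z) -scaleN1r mx2Z mx2D.
by congr mx2; ring.
Qed.

Lemma cayley_hamilton2_polar X Y :
  X *m Y + Y *m X = \tr X *: Y + \tr Y *: X + (\tr (X *m Y) - \tr X * \tr Y)%:M.
Proof.
rewrite [X]mx2_eta [Y]mx2_eta !(mx2M, mx2_tr, mx2_scalar, mx2Z, mx2D).
by congr mx2; ring.
Qed.

Lemma det_sub_scalar X a : \det (X - a%:M) = a ^+ 2 - \tr X * a + \det X.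
Proof.
rewrite [X]mx2_eta mx2_scalar -scaleN1r mx2Z mx2D !(mx2_det, mx2_tr); ring.
Qed.

Lemma emx_evalM m n : emx_eval R (emx_mul m n) = emx_eval R m * emx_eval R n.
Proof.
case: m => [[[a b] c] d]; case: n => [[[a' b'] c'] d'].
by rewrite -[RHS]/(_ *m _) /emx_eval mx2M /= !eis_evalD !eis_evalM.
Qed.

Lemma emx_eval_scale k m :
  emx_eval R (emx_scale k m) = eis_eval R k *: emx_eval R m.
Proof. by case: m => [[[a b] c] d]; rewrite /emx_eval mx2Z /= !eis_evalM. Qed.

Lemma eis_eval0 : eis_eval R (0, 0) = 0.
Proof. by rewrite /eis_eval /= mul0r addr0. Qed.

Lemma eis_eval1 : eis_eval R (1, 0) = 1.
Proof. by rewrite /eis_eval /= mul0r addr0. Qed.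

Lemma eis_eval_omega : eis_eval R (0, 1) = w.
Proof. by rewrite /eis_eval /= mul1r add0r. Qed.

Lemma eis_evalN_omega : eis_eval R (0, -1) = - w.
Proof. by rewrite /eis_eval /= mulN1r add0r. Qed.

Lemma emx_eval1 : emx_eval R emx1 = 1.
Proof. by rewrite /emx_eval /= eis_eval0 eis_eval1 -mx2_scalar. Qed.

Lemma emx_eval_inj : injective (emx_eval R).
Proof.
move=> [[[a b] c] d] [[[a' b'] c'] d'] /mx2_inj[].
by do 4 move=> /eis_eval_inj ->.
Qed.

Lemma emx_eval_det m : \det (emx_eval R m) = eis_eval R (emx_det m).
Proof.
case: m => [[[a b] c] d]; rewrite /emx_eval mx2_det /emx_det eis_evalD !eis_evalM.
by congr (_ + _); rewrite /eis_eval /= mul0r addr0 mulN1r.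
Qed.

Lemma emx_eval_tr m : \tr (emx_eval R m) = eis_eval R (emx_tr m).
Proof. by case: m => [[[a b] c] d]; rewrite /emx_eval mx2_tr /emx_tr eis_evalD. Qed.

Lemma rows_mul2 a b c d (P : 'M[C]_2) :
  mx2 a b c d *m P = \matrix_i (if i == 0 then a *: row 0 P + b *: row 1 P
                                else c *: row 0 P + d *: row 1 P).
Proof.
apply/matrixP => i j; rewrite !mxE !big_ord_recl big_ord0 addr0 !mxE.
have -> : lift ord0 ord0 = 1 :> 'I_2 by apply/val_inj.
by case: i => -[|[|//]] i /=; rewrite !mxE.
Qed.

(** Take a row r fixed by Y and put s = r (X - omega). The theorem of
    Cayley-Hamilton makes s fixed by X, and its polarized form together with the
    value of tr (X Y) gives the image of s under Y. In the rows r, s the pair is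
    therefore the Burau pair. They form a basis: the coefficients of linear
    relations between r and s are stable under the Burau matrices, which have no
    common eigenvector. *)
Lemma burau_basis X Y :
    \tr X = 1 + w -> \det X = w -> \tr Y = 1 + w -> \det Y = w ->
    \tr (X *m Y) = w ->
  exists P, [/\ P \in unitmx, P *m X = emx_eval R burau1 *m P
              & P *m Y = emx_eval R burau2 *m P].
Proof.
move=> trX detX trY detY trXY; have w2 := omega_sq R; have w_neq0 := omega_neq0 R.
have [r r_neq0 rY] : exists2 r : 'rV_2, r != 0 & r *m Y = r.
  have /eqP/det0P[r r0 rY] : \det (Y - 1%:M) = 0.
    by rewrite det_sub_scalar trY detY; ring.
  by exists r => //; apply/eqP; rewrite -subr_eq0 -[X in _ - X]mulmx1 -mulmxBr rY.
pose s := r *m X - w *: r.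
have rX : r *m X = w *: r + s by rewrite /s addrC subrK.
have sX : s *m X = s.
  have rXX : r *m X *m X = (1 + w) *: (r *m X) - w *: r.
    by rewrite -mulmxA cayley_hamilton2 trX detX mulmxBr -scalemxAr mul_mx_scalar.
  rewrite /s mulmxBl -scalemxAl rXX; move: (r *m X) => u.
  by apply/rowP => j; rewrite !mxE; ring.
have sY : s *m Y = - w *: r + w *: s.
  have rXY : r *m X *m Y = (1 + w) *: r + (1 + w) *: (r *m X) - r *m X.
    rewrite -mulmxA; apply/(canRL (addrK _)).
    have -> : r *m (X *m Y) + r *m X = r *m (X *m Y + Y *m X).
      by rewrite mulmxDr (mulmxA r Y) rY.
    rewrite cayley_hamilton2_polar trX trY trXY !mulmxDr -!scalemxAr rY.
    rewrite mul_mx_scalar.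
    have -> : w - (1 + w) * (1 + w) = - (w ^+ 2 + w + 1) by ring.
    by rewrite w2 subrK addNr oppr0 scale0r addr0 addrC.
  rewrite /s mulmxBl -scalemxAl rY rXY; move: (r *m X) => u.
  have ww : w * w = - 1 - w by rewrite -expr2.
  by apply/rowP => j; rewrite !mxE mulrDr mulrN mulrA ww; ring.
clearbody s.
pose P : 'M[C]_2 := \matrix_i (if i == 0 then r else s).
have P0 : row 0 P = r by rewrite rowK.
have P1 : row 1 P = s by rewrite rowK.
have ord2 (i : 'I_2) : i = 0 \/ i = 1.
  by case: i => -[|[|//]] i; [left | right]; apply/val_inj.
have evA : emx_eval R burau1 = mx2 w 1 0 1.
  by rewrite -eis_eval_omega -eis_eval1 -eis_eval0.
have evB : emx_eval R burau2 = mx2 1 0 (- w) w.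
  by rewrite -eis_evalN_omega -eis_eval_omega -eis_eval1 -eis_eval0.
have PX : P *m X = emx_eval R burau1 *m P.
  rewrite evA rows_mul2 P0 P1; apply/row_matrixP => i; rewrite row_mul !rowK.
  have [] := ord2 i => -> /=; first by rewrite scale1r.
  by rewrite scale0r add0r scale1r.
have PY : P *m Y = emx_eval R burau2 *m P.
  rewrite evB rows_mul2 P0 P1; apply/row_matrixP => i; rewrite row_mul !rowK.
  by have [] := ord2 i => -> //=; rewrite scale1r scale0r addr0.
(* A linear relation z between r and s; so are its images under the pair. *)
exists P; split=> //; rewrite unitmxE unitfE; apply/negP => /det0P[z z0 zP].
have comb (u : 'rV_2) : u *m P = 0 -> u 0 0 *: r + u 0 1 *: s = 0.
  move=> uP; have := congr1 (row 0) (rows_mul2 (u 0 0) (u 0 1) 0 0 P).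
  rewrite rowK /= P0 P1 => <-; rewrite row_mul.
  have -> : row 0 (mx2 (u 0 0) (u 0 1) 0 0) = u; last by [].
  apply/rowP => j; rewrite !mxE /=.
  by have [] := ord2 j => ->.
have := comb _ zP.
have zA : (z *m emx_eval R burau1) *m P = 0.
  by rewrite -mulmxA -PX mulmxA zP mul0mx.
have zB : (z *m emx_eval R burau2) *m P = 0.
  by rewrite -mulmxA -PY mulmxA zP mul0mx.
have := comb _ zA; have := comb _ zB; rewrite evA evB {zA zB zP}.
rewrite !mxE !big_ord_recl !big_ord0 !mxE /= !addr0.
have -> : lift ord0 ord0 = 1 :> 'I_2 by apply/val_inj.
set p := z 0 0; set q := z 0 1; rewrite !(mulr0, mulr1, addr0, add0r) => EB EA E0.
have /rV0Pn[j rj] := r_neq0.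
have {}E0 := congr1 (fun u : 'rV_2 => u 0 j) E0.
have {}EA := congr1 (fun u : 'rV_2 => u 0 j) EA.
have {}EB := congr1 (fun u : 'rV_2 => u 0 j) EB.
move: E0 EA EB; rewrite !mxE.
move: (r 0 j) (s 0 j) rj => a b a0 E0 EA EB.
have q0 : q != 0.
  apply: contraNneq z0 => q0; move: E0; rewrite q0 mul0r addr0 => /eqP.
  rewrite mulf_eq0 (negPf a0) orbF => /eqP p0.
  by apply/eqP/rowP => k; have [] := ord2 k => ->; rewrite mxE.
have {EB}EB : (w - 1) * b = w * a.
  apply/eqP; rewrite -subr_eq0 -(mulrI_eq0 _ (mulfI q0)); apply/eqP.
  have -> : q * ((w - 1) * b - w * a) =
    ((p + q * - w) * a + q * w * b) - (p * a + q * b) by ring.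
  by rewrite EB E0 subrr.
have /eqP : p * ((w - 1) * a + b) = 0.
  have -> : p * ((w - 1) * a + b) =
    (p * w * a + (p + q) * b) - (p * a + q * b) by ring.
  by rewrite EA E0 subrr.
rewrite mulf_eq0 => /orP[/eqP p0 | /eqP E].
  move: E0; rewrite p0 mul0r add0r => /eqP.
  rewrite mulf_eq0 (negPf q0) /= => /eqP b0.
  by move/eqP: EB; rewrite b0 mulr0 eq_sym mulf_eq0 (negPf w_neq0) (negPf a0).
have /eqP : 2 * w * a = 0.
  have -> : 2 * w * a = - ((w - 1) * ((w - 1) * a + b)) +
    ((w - 1) * b - w * a) + (w ^+ 2 + w + 1) * a by ring.
  by rewrite E EB w2 subrK addNr mulr0 oppr0 subrr mul0r !addr0.
by rewrite !mulf_eq0 pnatr_eq0 (negPf w_neq0) (negPf a0).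
Qed.

End Mx2.

(** * Generalities on generated groups, Hurwitz orbits and reflections *)

Section Hurwitz.
Local Open Scope classical_set_scope.
Variables (F : fieldType) (n : nat).
Implicit Types (g t : 'M[F]_n.+1) (W S : set 'M[F]_n.+1) (s u : seq 'M[F]_n.+1).

Lemma generated_groupP S : S `<=` [set g | g \in unitmx] ->
  is_GL_subgroup (generated_group S).
Proof.
move=> SU; split.
- apply: smallest_sub => //; split=> //=.
  + exact: unitmx1.
  + by move=> g w gU wU; rewrite unitmx_mul gU wU.
  + by move=> g gU; rewrite unitmx_inv.
- by move=> H [[_ H1 _ _] _].
- move=> g w gW wW H HS; have [[_ _ HM _] _] := HS.
  by apply: HM; [apply: gW | apply: wW].
- by move=> g gW H HS; have [[_ _ _ HV] _] := HS; apply: HV; apply: gW.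
Qed.

Lemma conj_class_conj W g t : is_GL_subgroup W -> W g ->
  conj_class W (g^-1 * t * g) = conj_class W t.
Proof.
move=> [WU _ WM WV] Wg.
have gU : g \is a GRing.unit := WU _ Wg.
apply/seteqP; split=> _ [w Ww <-].
  exists (g * w); first exact: WM.
  rewrite invrM // ?mulrA //; exact: (WU _ Ww).
exists (g^-1 * w); first by apply: WM => //; apply: WV.
have wU : w \is a GRing.unit := WU _ Ww.
by rewrite invrM ?unitrV // invrK !mulrA !mulrK.
Qed.

Lemma hurwitz_orbit_classes W s u : is_GL_subgroup W ->
  (forall t, t \in s -> W t) -> hurwitz_orbit s u ->
  (forall t, t \in u -> W t) /\ perm_eq (conj_classes W s) (conj_classes W u).
Proof.
move=> GW + su.
elim: su => {s u} [s u [i lt_i ->] sW | s sW | s v u _ IH1 _ IH2 sW].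
- have a_s := mem_nth 0 (ltnW lt_i); have b_s := mem_nth 0 lt_i.
  have sE : s = take i s ++ [:: s`_i; s`_i.+1] ++ drop i.+2 s.
    by rewrite -[LHS](cat_take_drop i) (drop_nth 0 (ltnW lt_i)) (drop_nth 0 lt_i).
  have [WU _ WM WV] := GW.
  rewrite /hurwitz_move; split.
    move=> t; rewrite !mem_cat !inE -!orbA.
    case/or4P=> [/mem_take/sW //|/eqP->|/eqP->|/mem_drop/sW //].
      exact: sW.
    exact: (WM _ _ (WM _ _ (WV _ (sW _ b_s)) (sW _ a_s)) (sW _ b_s)).
  rewrite {1}sE /conj_classes !map_cat perm_cat2l /= conj_class_conj //; last first.
    exact: sW.
  exact: (permEl (perm_catCA [:: _] [:: _] _)).
- by split.
- have [vW sv] := IH1 sW; have [uW vu] := IH2 vW.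
  by split=> //; apply: perm_trans sv vu.
Qed.

Lemma mem_fix t (v : 'cV[F]_n.+1) : (v \in fix_space t) = (t *m v == v).
Proof. by apply/fixedSpaceP/eqP; rewrite lfunE. Qed.

Lemma prim_eigenvalue_expr g (z : F) h k :
  h.-primitive_root z -> eigenvalue g z -> g ^+ k = 1 -> (h %| k)%N.
Proof.
move=> zh /eigenvalueP[v vg v0] gk; rewrite (prim_order_dvd zh).
have : v *m g ^+ k = z ^+ k *: v.
  elim: k {gk} => [|k IH]; first by rewrite !expr0 mulmx1 scale1r.
  by rewrite !exprS -[g * _]/(g *m _) mulmxA vg -scalemxAl IH scalerA.
rewrite gk mulmx1 => /eqP; rewrite -subr_eq0 -{1}[v]scale1r -scalerBl scaler_eq0.
by rewrite (negPf v0) orbF subr_eq0 eq_sym.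
Qed.

End Hurwitz.

Section Planar.
Variable R : realType.
Local Notation C := R[i].
Implicit Types t : 'M[C]_2.

Lemma det_sub1 t : \det (t - 1) = 1 - \tr t + \det t.
Proof. by rewrite det_sub_scalar expr1n mulr1. Qed.

Lemma is_reflection_tr t : is_reflection t -> t != 1 /\ \tr t = 1 + \det t.
Proof.
case=> _ dim_fix; split.
  apply/eqP=> t1; move: dim_fix; rewrite t1.
  have -> : fix_space (1 : 'M[C]_2) = fullv.
    by apply/vspaceP => v; rewrite mem_fix mul1mx eqxx memvf.
  by rewrite dimvf /dim /=.
have [v v_fix v0] : exists2 v, v \in fix_space t & v != 0.
  exists (vpick (fix_space t)); first exact: memv_pick.
  by rewrite vpick0 -dimv_eq0 dim_fix.
have /eqP : \det (t - 1) = 0.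
  rewrite -det_tr; apply/eqP/det0P; exists v^T; first by rewrite trmx_eq0.
  rewrite -trmx_mul mulmxBl mul1mx; rewrite mem_fix in v_fix.
  by rewrite (eqP v_fix) subrr trmx0.
by rewrite det_sub1 addrAC subr_eq0 => /eqP.
Qed.

Lemma tr_is_reflection t m : (0 < m)%N -> t ^+ m = 1 -> t != 1 ->
  \tr t = 1 + \det t -> is_reflection t.
Proof.
move=> m0 tm t1 trt; split; first by exists m.
have : \det (t - 1)^T = 0 by rewrite det_tr det_sub1 trt; ring.
move/eqP/det0P=> [u u0 ut].
have u_fix : u^T \in fix_space t.
  rewrite mem_fix -subr_eq0 -[X in _ - X]mul1mx -mulmxBl.
  by rewrite -[_ *m _]trmxK trmx_mul trmxK ut trmx0.
apply/eqP; rewrite eqn_leq; apply/andP; split; last first.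
  rewrite lt0n dimv_eq0; apply: contraNneq u0 => fix0.
  by rewrite fix0 memv0 trmx_eq0 in u_fix.
rewrite leqNgt; apply: contraNN t1 => dim2.
have fixT : fix_space t = fullv.
  by apply/eqP; rewrite eqEdim subvf dimvf /dim /=.
apply/eqP/matrixP => i j.
have : delta_mx j 0 \in fix_space t by rewrite fixT memvf.
rewrite mem_fix -colE => /eqP/(congr1 (fun v : 'cV_2 => v i 0)).
by rewrite !mxE eqxx andbT.
Qed.

End Planar.

(** * Groups generated by two letters *)

Section Representation.
Local Open Scope classical_set_scope.
Variables (R : realType) (P : 'M[R[i]]_2).
Hypothesis P_unit : P \is a GRing.unit.
Local Notation C := R[i].
Local Notation emx_eval := (emx_eval R).
Local Notation eis_eval := (eis_eval R).
Implicit Types (x y : letter bool) (M N : 'M[C]_2).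

(** The matrix P is a change of basis. The locking keeps unification from
    computing with matrices. *)
Definition letter_rep x : 'M[C]_2 := locked (P^-1 * emx_eval (letter_mx x) * P).
Local Notation rho := letter_rep.

Lemma letter_repE x : P * rho x = emx_eval (letter_mx x) * P.
Proof. by rewrite /rho -lock !mulrA divrr // mul1r. Qed.

Lemma letter_repME x M : P * (rho x * M) = emx_eval (letter_mx x) * (P * M).
Proof. by rewrite mulrA letter_repE mulrA. Qed.

Lemma emx_eval_conj_inj m m' : emx_eval m * P = emx_eval m' * P -> m = m'.
Proof. by move/(mulIr P_unit)/emx_eval_inj. Qed.

Lemma letter_rep_inj : injective rho.
Proof.
move=> x y xy; apply/letter_mx_inj/emx_eval_conj_inj.
by rewrite -!letter_repE xy.
Qed.

Lemma letter_rep_swap x y : rho x * rho y = rho y * rho (conj_letter x y).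
Proof.
apply: (mulrI P_unit); rewrite [LHS]letter_repME [RHS]letter_repME.
rewrite (letter_repE y) (letter_repE (conj_letter x y)) 2!mulrA.
by rewrite -emx_evalM letter_mx_conj emx_evalM.
Qed.

Lemma letter_rep_inv x : rho x * rho (inv_letter x) = 1.
Proof.
apply: (mulrI P_unit); rewrite letter_repME letter_repE mulrA -emx_evalM.
by rewrite letter_mx_inv emx_eval1 mul1r mulr1.
Qed.

Lemma inv_letterK x : inv_letter (inv_letter x) = x.
Proof. by case: x => p [d c]; rewrite /inv_letter /= negbK. Qed.

Lemma letter_rep_unit x : rho x \is a GRing.unit.
Proof.
apply/unitrP; exists (rho (inv_letter x)); rewrite letter_rep_inv; split=> //.
by rewrite -{2}[x]inv_letterK letter_rep_inv.
Qed.

Lemma letter_repV x : (rho x)^-1 = rho (inv_letter x).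
Proof.
apply: (mulrI (letter_rep_unit x)).
by rewrite divrr ?letter_rep_unit // letter_rep_inv.
Qed.

Lemma letter_rep_conj x y : (rho y)^-1 * rho x * rho y = rho (conj_letter x y).
Proof. by rewrite -mulrA letter_rep_swap mulKr ?letter_rep_unit. Qed.

Lemma letter_rep_cube x : rho x ^+ 3 = 1.
Proof.
have xx : rho x * rho x = rho (inv_letter x).
  apply: (mulrI P_unit); rewrite letter_repME !letter_repE mulrA -emx_evalM.
  by rewrite letter_mx_sq.
by rewrite !exprS expr0 mulr1 xx letter_rep_inv.
Qed.

Lemma conj_tr M : \tr (P^-1 * M * P) = \tr M.
Proof.
by rewrite -mulrA -[LHS]/(\tr (P^-1 *m _)) mxtrace_mulC -[_ *m _]/(_ * _) mulrK.
Qed.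

Lemma conj_det M : \det (P^-1 * M * P) = \det M.
Proof.
have P_det : \det P != 0 by rewrite -unitfE.
by rewrite -!mulmxE !det_mulmx det_inv mulrAC mulVf // mul1r.
Qed.

Lemma letter_rep_reflection x : is_reflection (rho x).
Proof.
apply: (@tr_is_reflection _ _ 3) => //; first exact: letter_rep_cube.
  apply: contra (letter_mx_neq1 x) => /eqP x1.
  by apply/eqP/emx_eval_conj_inj; rewrite -letter_repE x1 mulr1 emx_eval1 mul1r.
rewrite /rho -lock conj_tr conj_det emx_eval_tr emx_eval_det letter_mx_refl.
by rewrite eis_evalD eis_eval1.
Qed.

(** The factors [color_unit] come out of the product as a scalar that depends
    only on the labels. *)
Lemma letter_rep_faithful (u w : seq (letter bool)) : unzip2 u = unzip2 w ->
  \prod_(x <- u) rho x = \prod_(x <- w) rho x ->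
  emx_word (unzip1 u) (dirs u) = emx_word (unzip1 w) (dirs w).
Proof.
pose k (l : bool * bool) : C := eis_eval (color_unit l.1 l.2).
have prodE v : P * (\prod_(x <- v) rho x) =
    (\prod_(l <- unzip2 v) k l) *: (emx_eval (emx_word (unzip1 v) (dirs v)) * P).
  elim: v => [|x v IH].
    by rewrite !big_nil -[emx_word _ _]/emx1 emx_eval1 mulr1 mul1r scale1r.
  rewrite !big_cons letter_repME IH /letter_mx emx_eval_scale.
  by rewrite -scalerAl -scalerAr scalerA !mulrA -emx_evalM.
move=> uw prod_uw; have := prodE w; rewrite -prod_uw prodE uw.
have k_neq0 : \prod_(l <- unzip2 w) k l != 0.
  rewrite prodf_seq_neq0; apply/allP => -[d c] _ /=.
  rewrite /k -eis_eval0 (inj_eq (@eis_eval_inj R)).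
  by case: d c => [] [].
by move/(scalerI k_neq0)/emx_eval_conj_inj.
Qed.

(** Letters with the same point commute and have order 3. *)
Lemma prod_constant (w : seq (letter bool)) :
  ~~ nonconstant w -> (\prod_(x <- w) rho x) ^+ 3 = 1.
Proof.
rewrite negbK => /constant_all[p wp].
have comm_p v y : all (pred1 p) (unzip1 v) -> y.1 = p ->
    GRing.comm (rho y) (\prod_(x <- v) rho x).
  move=> /allP vp yp; rewrite big_seq; apply: commr_prod => x xv.
  have /eqP xp := vp _ (map_f fst xv).
  by rewrite /GRing.comm letter_rep_swap conj_letter_same // yp xp.
elim: w wp => [|x w IH] /=; first by rewrite big_nil expr1n.
case/andP=> /eqP xp wp; rewrite big_cons exprMn_comm; last exact: comm_p.
by rewrite letter_rep_cube mul1r IH.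
Qed.

Lemma hurwitz_braid b w : hurwitz_orbit (map rho w) (map rho (braid b w)).
Proof.
elim: b w => [|i b IH] w; first exact: rt_refl.
apply: rt_trans (IH (braid_move i w)).
have [lt_i | ge_i] := ltnP i.+1 (size w); last first.
  suff -> : braid_move i w = w by apply: rt_refl.
  elim: i w ge_i {IH} => [|i IH] [|x w] //=; first by case: w.
  by move=> ge_i; rewrite IH.
apply: rt_step; exists i; rewrite ?size_map // /hurwitz_move.
elim: i w lt_i {IH} => [|i IH] [|x w] //= lt_i.
  by case: w lt_i => //= y w _; rewrite letter_rep_conj drop0.
by rewrite IH.
Qed.

Section Group.
Variables x0 y0 : letter bool.
Let W := generated_group [set rho x0; rho y0].

Lemma letter_group_GL : is_GL_subgroup W.
Proof. by apply: generated_groupP => M [] -> /=; apply: letter_rep_unit. Qed.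

Lemma letter_group_sub (H : set 'M[C]_2) :
  is_GL_subgroup H -> (forall x, H (rho x)) -> W `<=` H.
Proof. by move=> GH Hr; apply: smallest_sub => // M [] ->. Qed.

Definition in_G5 M := exists2 g, g \in G5_elements & P * M = emx_eval g * P.

(** The elements by which right multiplication, and that of their inverses,
    preserves the list of 72 elements form a group; it contains the letters. *)
Lemma letter_group_in_G5 M : W M -> in_G5 M.
Proof.
pose H := [set M : 'M[C]_2 | M \in unitmx /\
  forall N, in_G5 N -> in_G5 (N * M) /\ in_G5 (N * M^-1)].
have GH : is_GL_subgroup H.
  split.
  - by move=> M' [].
  - by split=> [|N NG]; rewrite ?unitmx1 // invr1 mulr1.
  - move=> g w [gU gH] [wU wH]; split=> [|N NG]; first by rewrite unitmx_mul gU.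
    rewrite invrM //; split; rewrite mulrA.
      by apply: (wH _ _).1; apply: (gH _ _).1.
    by apply: (gH _ _).2; apply: (wH _ _).2.
  - move=> g [gU gH]; split=> [|N NG]; first by rewrite unitmx_inv.
    by rewrite invrK; split; [apply: (gH _ NG).2 | apply: (gH _ NG).1].
move=> WM; have [] : H M.
  move: M WM; apply: letter_group_sub => // x; split; first exact: letter_rep_unit.
  have closed y N : in_G5 N -> in_G5 (N * rho y).
    case=> g gG NE; exists (emx_mul g (letter_mx y)).
      exact: G5_elements_closed.
    by rewrite mulrA NE -[LHS]mulrA letter_repE mulrA -emx_evalM.
  by move=> N NG; rewrite letter_repV; split; apply: closed.
move=> _ /(_ 1)[]; last by rewrite mul1r.
by exists emx1; [vm_compute | rewrite mulr1 emx_eval1 mul1r].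
Qed.

Lemma reflection_is_letter M : reflections W M -> exists x, M = rho x.
Proof.
case=> /letter_group_in_G5[g gG gE] /is_reflection_tr[M1 trM].
have ME : M = P^-1 * emx_eval g * P by rewrite -mulrA -gE mulKr.
have trE : \tr M = eis_eval (emx_tr g) by rewrite ME conj_tr emx_eval_tr.
have detE : \det M = eis_eval (emx_det g) by rewrite ME conj_det emx_eval_det.
have [||x gx] := G5_reflections gG.
- by apply: contraNneq M1 => g1; rewrite ME g1 emx_eval1 mulr1 mulVr.
- by apply: (@eis_eval_inj R); rewrite eis_evalD eis_eval1 -trE -detE.
by exists x; rewrite /rho -lock ME gx.
Qed.

Lemma factorization_is_word (t : seq 'M[C]_2) :
  (forall M, M \in t -> reflections W M) -> exists w, t = map rho w.
Proof.
elim: t => [|M t IH] tW; first by exists [::].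
have [x ->] := reflection_is_letter (tW M (mem_head _ _)).
have [|w ->] := IH; last by exists (x :: w).
by move=> N Nt; apply: tW; rewrite inE Nt orbT.
Qed.

(** Every element of the group permutes the letters of each label. *)
Lemma letter_rep_class_label x y :
  conj_class W (rho x) = conj_class W (rho y) -> x.2 = y.2.
Proof.
move=> xy.
have sub_preserves : W `<=` [set M | preserves_labels rho M].
  apply: letter_group_sub => [|z]; last first.
    exact: (preserves_labels_rho letter_rep_unit letter_rep_swap).
  split; [by move=> M [] | exact: preserves_labels1 | |].
    exact: preserves_labelsM.
  exact: preserves_labelsV.
have : conj_class W (rho x) (rho x).
  by exists 1; [case: letter_group_GL | rewrite invr1 mul1r mulr1].
rewrite xy => -[g /sub_preserves gP gE].
by rewrite (preserves_labels_conj gP letter_rep_inj gE).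
Qed.

Definition eight_letters : seq (letter bool) :=
  [:: x0; y0; conj_letter x0 y0; conj_letter y0 x0;
      inv_letter x0; inv_letter y0;
      inv_letter (conj_letter x0 y0); inv_letter (conj_letter y0 x0)].

(** Half the number of reflections is a lower bound for the Coxeter number, and the
    two generating letters already produce eight of them. *)
Lemma coxeter_number_ge4 : uniq eight_letters -> (3 < coxeter_number W)%N.
Proof.
set s := eight_letters => s_uniq.
have [_ W1 WM WV] := letter_group_GL.
have Wx : W (rho x0) by apply: sub_gen_smallest; left.
have Wy : W (rho y0) by apply: sub_gen_smallest; right.
have Winv x : W (rho x) -> W (rho (inv_letter x)).
  by rewrite -letter_repV; apply: WV.
have Wconj x y : W (rho x) -> W (rho y) -> W (rho (conj_letter x y)).
  move=> Wx' Wy'; rewrite -letter_rep_conj.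
  by apply: (WM) => //; apply: (WM) => //; apply: WV.
have sW x : x \in s -> reflections W (rho x).
  move=> xs; split; last exact: letter_rep_reflection.
  move: xs; rewrite /s /eight_letters !inE.
  do 7 ! [case/orP=> [/eqP->|]; first by auto].
  by move/eqP->; auto.
have fin : finite_set (reflections W).
  apply: (@sub_finite_set _ _ (rho @` [set` letters])).
    by move=> M /reflection_is_letter[x ->]; exists x => //; apply: mem_letters.
  exact/finite_image/finite_seq.
have s8 : size s = 8 by [].
(* From now on s is abstract, so that membership in s does not unfold. *)
clearbody s.
have : ([fset M in map rho s] `<=` fset_set (reflections W))%fset.
  apply/fsubsetP => M; rewrite !inE /= => /mapP[x xs ->].
  by rewrite in_fset_set // inE; apply: sW.
move/fsubset_leq_card; rewrite card_fseq undup_id ?map_inj_uniq //; last first.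
  exact: letter_rep_inj.
rewrite size_map s8 => c8.
rewrite /coxeter_number leq_divRL //.
exact: leq_trans c8 (leq_addr _ _).
Qed.

Theorem hurwitz_letter_group (c : 'M[C]_2) (k : nat) (t t' : k.-tuple 'M[C]_2) :
  uniq eight_letters ->
  coxeter_element W c ->
  reflection_factorization W c t ->
  reflection_factorization W c t' ->
  hurwitz_orbit t t' <-> perm_eq (conj_classes W t) (conj_classes W t').
Proof.
move=> /coxeter_number_ge4 h4 [Wc [z zh zc]] [tW tc] [tW' tc']; split.
  by case/(hurwitz_orbit_classes letter_group_GL) => // M /tW[].
have [u tu] := factorization_is_word tW.
have [u' tu'] := factorization_is_word tW'.
move=> cls.
have c_nc v : \prod_(M <- map rho v) M = c -> nonconstant v.
  rewrite big_map => vc; apply: contraLR h4 => /prod_constant; rewrite vc => c3.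
  by rewrite -leqNgt dvdn_leq // (prim_eigenvalue_expr zh zc).
have labels : perm_eq (unzip2 u) (unzip2 u').
  move: cls; rewrite tu tu' /conj_classes -!map_comp => cls.
  (* The label is a function of the class, so it passes through [perm_eq]. *)
  pose label_of (S : set 'M[C]_2) := (xget x0 [set x | conj_class W (rho x) = S]).2.
  have labelE v : unzip2 v = map label_of (map (conj_class W \o rho) v).
    rewrite -map_comp; apply: eq_map => x; apply: letter_rep_class_label.
    apply/esym/(@xgetPex _ x0 [set y | conj_class W (rho y) = conj_class W (rho x)]).
    by exists x.
  by rewrite !labelE; apply: perm_map.
have [b bE] : braid_equiv u u'.
  apply: (braid_equiv_of_prod letter_rep_unit letter_rep_swap) => //.
  - exact: letter_rep_faithful.
  - by apply: c_nc; rewrite -tu.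
  - by apply: c_nc; rewrite -tu'.
  - by rewrite -(big_map rho xpredT id) -tu tc -tc' tu' big_map.
by rewrite tu tu' -bE; apply: hurwitz_braid.
Qed.

End Group.

End Representation.

(** * The generators of G4 and G5 *)

Section Generators.
Variable R : realType.
Local Notation C := R[i].
Local Notation w := (omega R).
Implicit Types (A B P : 'M[C]_2).

Lemma letter_rep_eq P A x : P \is a GRing.unit ->
  P * A = emx_eval R (letter_mx x) * P -> A = letter_rep P x.
Proof. by move=> P_unit PA; apply: (mulrI P_unit); rewrite PA letter_repE. Qed.

Lemma eigenvalue_det A z : eigenvalue A z -> z ^+ 2 - \tr A * z + \det A = 0.
Proof.
case/eigenvalueP=> v vA v0; rewrite -det_sub_scalar; apply/eqP/det0P.
by exists v; rewrite // mulmxBr vA mul_mx_scalar subrr.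
Qed.

Lemma G5_generator_tr_det A : G5_generator A -> \tr A = 1 + w /\ \det A = w.
Proof.
case=> _ _ _ eigA; have w2 := omega_sq R.
have E1 := eigenvalue_det ((eigA 1).2 (or_introl erefl)).
have Ew := eigenvalue_det ((eigA w).2 (or_intror erefl)).
have w1 : w - 1 != 0.
  rewrite subr_eq0; apply/eqP=> w1; move: w2; rewrite w1 expr1n => one.
  have /eqP : (3 : C) = 0 by rewrite -[RHS](subrr 1) [in X in _ - X]one; ring.
  by rewrite pnatr_eq0.
have trA : \tr A = 1 + w.
  apply: (mulfI w1); apply/eqP; rewrite -subr_eq0; apply/eqP.
  have -> : (w - 1) * \tr A - (w - 1) * (1 + w) =
     (1 ^+ 2 - \tr A * 1 + \det A) - (w ^+ 2 - \tr A * w + \det A) by ring.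
  by rewrite E1 Ew subrr.
split=> //; move: E1; rewrite trA expr1n mulr1 opprD addrA subrr add0r => /eqP.
by rewrite addrC subr_eq0 => /eqP.
Qed.

Lemma G4_basis : exists2 P, P \is a GRing.unit &
  G4_A R = letter_rep P ((false, false), (false, false)) /\
  G4_B R = letter_rep P ((true, false), (false, false)).
Proof.
have w2 := omega_sq R; have n3 : 3 != 0 :> C by rewrite pnatr_eq0.
have [|||||P [P_unit PA PB]] := @burau_basis R (G4_A R) (G4_B R).
- by rewrite mx2_tr.
- by rewrite mx2_det; ring.
- by rewrite mx2_tr w2; field.
- rewrite mx2_det.
  transitivity (w ^+ 2 * (8 * w ^+ 2 - w - 1) / 9); first by field.
  rewrite w2; transitivity (w ^+ 2 + 2 * w + 1); first by field.
  by rewrite w2; ring.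
- rewrite mx2M mx2_tr.
  transitivity ((w - 2 * w ^+ 2 * (1 + w)) / 3); first by field.
  rewrite w2; transitivity ((w + 2 * (w ^+ 2 + 2 * w + 1)) / 3); first by field.
  by rewrite w2; field.
have P_unit' : P \is a GRing.unit := P_unit.
by exists P => //; split; apply: letter_rep_eq.
Qed.

(** By Cayley-Hamilton, (A B)^2 = (B A)^2 reads tr (A B) (A B - B A) = 0, whence
    tr (A B) = 0. The adjugate Y = tr B - B of B, which is omega B^-1, is again a
    reflection of determinant omega, and tr (A Y) = (tr A)(tr B) - tr (A B) = omega:
    so A and Y form a Burau pair. *)
Lemma G5_basis A B : G5_generator A -> G5_generator B -> A * B != B * A ->
    A * B * A * B = B * A * B * A ->
  exists2 P, P \is a GRing.unit &
  A = letter_rep P ((false, false), (false, false)) /\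
  B = letter_rep P ((true, false), (true, true)).
Proof.
move=> /G5_generator_tr_det[trA detA] /G5_generator_tr_det[trB detB] AB ABAB.
have w2 := omega_sq R.
have trAB : \tr (A *m B) = 0.
  have := ABAB; rewrite -!mulrA [LHS]mulrA [RHS]mulrA.
  rewrite -[LHS]/((A *m B) *m (A *m B)) -[RHS]/((B *m A) *m (B *m A)).
  rewrite !cayley_hamilton2 !det_mulmx mulrC [\tr (B *m A)]mxtrace_mulC.
  move/addIr/eqP; rewrite -subr_eq0 -scalerBr scaler_eq0 => /orP[/eqP //|].
  by rewrite subr_eq0 => /eqP E; rewrite -[A * B]/(A *m B) E eqxx in AB.
pose Y : 'M[C]_2 := (1 + w)%:M - B.
have trY : \tr Y = 1 + w.
  by rewrite /Y linearB /= mxtrace_scalar trB; ring.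
have detY : \det Y = w.
  have -> : Y = - (B - (1 + w)%:M) by rewrite opprB.
  rewrite -scaleN1r detZ det_sub_scalar trB detB; ring.
have trAY : \tr (A *m Y) = w.
  rewrite mulmxBr linearB /= trAB mul_mx_scalar linearZ /= trA subr0.
  rewrite -expr2; transitivity (w ^+ 2 + w + 1 + w); first by ring.
  by rewrite w2 subrK addNr add0r.
have [P [P_unit PA PY]] := burau_basis trA detA trY detY trAY.
have P_unit' : P \is a GRing.unit := P_unit.
exists P => //; split; apply: letter_rep_eq => //.
have -> : B = (1 + w)%:M - Y by rewrite /Y opprB addrC subrK.
rewrite mulrBr -[P * Y]/(P *m Y) PY -[P * _]/(P *m _) mul_mx_scalar.
rewrite -[emx_eval R burau2 *m P]/(emx_eval R burau2 * P) -mul_scalar_mx.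
rewrite -[_%:M *m P]/(_%:M * P) -mulrBl.
congr (_ * P).
have -> : letter_mx ((true, false), (true, true)) =
    ((0, 1), (0, 0), (0, 1), (1, 0)) :> emx by [].
rewrite /emx_eval mx2_scalar -scaleN1r mx2Z mx2D eis_eval0 eis_eval1 eis_eval_omega.
by congr mx2; rewrite /eis_eval /=; ring.
Qed.

End Generators.

Theorem theorem1p2 (R : realType) (W : set 'M[R[i]]_2) (c : 'M[R[i]]_2)
    (k : nat) (t t' : k.-tuple 'M[R[i]]_2) :
  W = G4 R \/ is_G5 W ->
  coxeter_element W c ->
  reflection_factorization W c t ->
  reflection_factorization W c t' ->
  hurwitz_orbit t t' <-> perm_eq (conj_classes W t) (conj_classes W t').
Proof.
case=> [-> | [A [B [genA genB AB ABAB [-> _]]]]].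
  have [P P_unit [EA EB]] := G4_basis R.
  rewrite /G4 EA EB; exact: hurwitz_letter_group.
have [P P_unit [-> ->]] := G5_basis genA genB AB ABAB.
exact: hurwitz_letter_group.
Qed.
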